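(* Let $\mathcal{L}$ be a Lipschitz continuous signature and let $(\Delta,V)$ be a normal good value pair for $\mathcal{L}$. Then $H_{(\Delta,V)}$, equipped with the subspace topology of $\mathrm{Iso}(\mathbb{U}_{(\Delta,V)})$, has the strong Lévy property.
   Context: All topological spaces are assumed Hausdorff. A topological group $G$ has the strong Lévy property if there is an increasing sequence $(K_i)_{i\in\mathbb{N}}$ of finite subgroups of $G$, with normalized counting measures $\mu_i$ on $K_i$ (regarded as measures on $G$), such that (i) $\bigcup_i K_i$ is dense in $G$, and (ii) for each open neighborhood $V$ of the identity and each sequence of sets $A_i\subseteq K_i$ with $\liminf_i\mu_i(A_i)>0$, one has $\lim_i\mu_i(VA_i)=1$. A modulus of continuity is a nondecreasing function $u\colon(0,\infty)\to(0,\infty]$ with $\lim_{x\to0}u(x)=0$ (we put $u(0)=0$). A map $f$ between metric spaces is uniformly continuous with respect to $u$ if $d_2(f(x),f(y))\le u(d_1(x,y))$ for all $x,y$. A continuous signature $\mathcal{L}$ here consists of a distance symbol $d$ and finitely many relation symbols $R$, each with an arity $n\ge1$ and, for each coordinate $1\le i\le n$, a modulus of continuity $u_{R,i}$ (there are no function symbols). An $\mathcal{L}$-pre-structure is a metric space $(A,d_A)$ with, for each $n$-ary $R\in\mathcal{L}$, a function $R^A\colon A^n\to[0,1]$ that is uniformly continuous in its $i$-th coordinate with respect to $u_{R,i}$ (the other coordinates being fixed), for each $i$; it is an $\mathcal{L}$-structure if $(A,d_A)$ is complete. Embeddings and isomorphisms preserve the metric and all relations. Let $I_{R,i}=\{r\in[0,+\infty]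 : u_{R,i}(r)<1\}$. $\mathcal{L}$ is semiproper if for every $n$-ary $R$ and $1\le i\le n$, $I_{R,i}$ is bounded and $u_{R,i}(r_1+r_2)\ge u_{R,i}(r_1)+u_{R,i}(r_2)$ for all $r_1,r_2\in I_{R,i}$, and for every $n$-ary $R$ with $n\ge2$ and $1\le i\le n$ there is $K_{R,i}>0$ with $u_{R,i}(r)=K_{R,i}r$ for all $r\in I_{R,i}$. $\mathcal{L}$ is proper if it is semiproper and each $u_{R,i}$ is upper semicontinuous on $I_{R,i}$. $\mathcal{L}$ is Lipschitz if it is proper and for each unary $R$ there is $K_{R,1}>0$ with $u_{R,1}(r)=K_{R,1}r$ for all $r\in I_{R,1}$. A distance value set is a nonempty set $\Delta$ of positive reals with $\min\{x+y,\sup\Delta\}\in\Delta$ for all $x,y\in\Delta$. For a distance value set $\Delta$ and $V\subseteq[0,1]$, $(\Delta,V)$ is a good value pair for $\mathcal{L}$ if: whenever $\Delta$ is bounded, $u_{R,i}(\sup\Delta)\ge1$ for all $n$-ary $R\in\mathcal{L}$ and $1\le i\le n$; $0\in V$; and for all $v\in V$, $\delta\in\Delta$, $n$-ary $R\in\mathcal{L}$, $1\le i\le n$, if $v>u_{R,i}(\delta)$ then $v-u_{R,i}(\delta)\in V$. It is normal if $\Delta=\mathbb{Q}^+$ (the positive rationals), $V$ is countable, and $\frac1n\sum_{i=1}^n v_i\in V$ for all $n\ge1$ and $v_1,\dots,v_n\in V$. An $\mathcal{L}$-pre-structure $\mathcal{M}$ is $(\Delta,V)$-valued if all its nonzero distances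 lie in $\Delta$ and all values $R^M(\bar x)$ lie in $V$. Let $\mathcal{K}_{(\Delta,V)}$ be the class of all finite $(\Delta,V)$-valued $\mathcal{L}$-structures; it is a countable Fraïssé class, with Fraïssé limit $\mathbb{U}_{(\Delta,V)}$ (a countable pre-structure). $\mathrm{Iso}(\mathbb{U}_{(\Delta,V)})$ is the group of all automorphisms of $\mathbb{U}_{(\Delta,V)}$ with the pointwise convergence topology, where $\mathbb{U}_{(\Delta,V)}$ carries its metric topology. Let $\mathcal{C}_{(\Delta,V)}$ be the class of actions by automorphisms $G\curvearrowright\mathcal{M}$ with $G$ a finite group and $\mathcal{M}\in\mathcal{K}_{(\Delta,V)}$; an embedding from $G_1\curvearrowright\mathcal{M}_1$ to $G_2\curvearrowright\mathcal{M}_2$ is a pair $(\phi,\pi)$ of a group embedding $\phi\colon G_1\to G_2$ and an $\mathcal{L}$-embedding $\pi\colon\mathcal{M}_1\to\mathcal{M}_2$ with $\phi(g)\cdot\pi(x)=\pi(g\cdot x)$. It is known that $\mathcal{C}_{(\Delta,V)}$ is a countable Fraïssé class; its Fraïssé limit is denoted $H_{(\Delta,V)}\curvearrowright\mathcal{M}_{(\Delta,V)}$. It is known that $\mathcal{M}_{(\Delta,V)}$ is isomorphic to $\mathbb{U}_{(\Delta,V)}$, and that $H_{(\Delta,V)}$ is isomorphic to Hall's universal locally finite group and acts faithfully on $\mathcal{M}_{(\Delta,V)}$; identifying $\mathcal{M}_{(\Delta,V)}$ with $\mathbb{U}_{(\Delta,V)}$, $H_{(\Delta,V)}$ is regarded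 as a subgroup of $\mathrm{Iso}(\mathbb{U}_{(\Delta,V)})$. *)

(* Defs.v *)
From HB Require Import structures.
From mathcomp Require Import all_boot all_order all_algebra finmap.
From mathcomp Require Import all_classical all_reals all_analysis.
From mathcomp Require fingroup.
Import fingroup.FinGroup.Exports.

Set Implicit Arguments.
Unset Strict Implicit.
Unset Printing Implicit Defensive.

Import Order.TTheory GRing.Theory Num.Theory.
Import numFieldNormedType.Exports.

Local Open Scope classical_set_scope.
Local Open Scope ring_scope.

HB.mixin Record Topological_isTopologicalGroup G
    of Group G & Topological G := {
  mulg_continuous : continuous (fun xy : G * G => (xy.1 * xy.2)%g);
  invg_continuous : continuous (fun x : G => (x^-1)%g);
  topgroup_hausdorff : hausdorff_space G
}.

#[short(type="topologicalGroupType")]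
HB.structure Definition TopologicalGroup :=
  {G of Group G & Topological G & Topological_isTopologicalGroup G}.

Record subgroup (G : groupType) := Subgroup {
  subgroup_set :> set G;
  subgroup_closed : group_closed [in subgroup_set]
}.

Definition subgroup_type (G : groupType) (H : subgroup G) : Type :=
  set_type (subgroup_set H).

Section subgroup_group.
Context (G : groupType) (H : subgroup G).

HB.instance Definition _ := SubChoice.copy (subgroup_type H) (set_type H).
HB.instance Definition _ :=
  SubChoice_isSubGroup.Build G [in subgroup_set H] (subgroup_type H)
    (subgroup_closed H).

Definition subgroup_val : subgroup_type H -> G := set_val.

Lemma subgroup_val_inj : injective subgroup_val.
Proof. exact: val_inj. Qed.

Lemma subgroup_valM x y :
  subgroup_val (x * y)%g = (subgroup_val x * subgroup_val y)%g.
Proof. by []. Qed.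

Lemma subgroup_val1 : subgroup_val 1%g = 1%g.
Proof.
by apply: (mulgI (subgroup_val 1%g)); rewrite -subgroup_valM !mulg1.
Qed.

Lemma subgroup_valV x : subgroup_val (x^-1)%g = ((subgroup_val x)^-1)%g.
Proof.
by apply: (mulgI (subgroup_val x)); rewrite -subgroup_valM !mulgV subgroup_val1.
Qed.

End subgroup_group.

Section subgroup_topology.
Context (G : topologicalGroupType) (H : subgroup G).

HB.instance Definition _ :=
  Topological.copy (subgroup_type H) (set_type (subgroup_set H)).

Lemma subgroup_val_continuous : continuous (@subgroup_val G H).
Proof. exact: initial_continuous. Qed.

Let subgroup_mul_continuous :
  continuous (fun xy : subgroup_type H * subgroup_type H => (xy.1 * xy.2)%g).
Proof.
apply: (@continuous_comp_initial (set_type H) _ G (@subgroup_val G H)) => -[x y].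
rewrite /continuous_at.
have -> : @subgroup_val G H \o (fun xy : subgroup_type H * subgroup_type H =>
    (xy.1 * xy.2)%g) = fun xy => (subgroup_val xy.1 * subgroup_val xy.2)%g.
  by apply/funext => -[u v]; exact: subgroup_valM.
apply: (@cvg_comp _ _ _ (fun xy : subgroup_type H * subgroup_type H =>
   (subgroup_val xy.1, subgroup_val xy.2)) (fun uv : G * G => (uv.1 * uv.2)%g)); last first.
  exact: (@mulg_continuous G (subgroup_val x, subgroup_val y)).
apply: cvg_pair => /=.
  by apply: (cvg_comp _ _ cvg_fst); exact: subgroup_val_continuous.
by apply: (cvg_comp _ _ cvg_snd); exact: subgroup_val_continuous.
Qed.

Let subgroup_inv_continuous :
  continuous (fun x : subgroup_type H => (x^-1)%g).
Proof.
apply: (@continuous_comp_initial (set_type H) _ G (@subgroup_val G H)) => x.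
rewrite /continuous_at.
have -> : @subgroup_val G H \o (fun x : subgroup_type H => (x^-1)%g) =
    (fun x : G => (x^-1)%g) \o @subgroup_val G H.
  by apply/funext => u; exact: subgroup_valV.
by apply: continuous_comp; [exact: subgroup_val_continuous|exact: invg_continuous].
Qed.

Let subgroup_hausdorff : hausdorff_space (subgroup_type H).
Proof.
move=> p q pq; apply: subgroup_val_inj; apply: (@topgroup_hausdorff G).
move=> A B /subgroup_val_continuous pA /subgroup_val_continuous qB.
by have [z [Az Bz]] := pq _ _ pA qB; exists (subgroup_val z).
Qed.

HB.instance Definition _ := Topological_isTopologicalGroup.Build
  (subgroup_type H) subgroup_mul_continuous subgroup_inv_continuous
  subgroup_hausdorff.

End subgroup_topology.

Section strong_levy.
Context (R : realType) (G : topologicalGroupType).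

Definition unif_counting (K A : set G) : R :=
  #|` fset_set (A `&` K)|%:R / #|` fset_set K|%:R.

Definition strong_levy : Prop :=
  exists K : nat -> subgroup G,
  [/\ (forall i, finite_set (K i)),
      (forall i, K i `<=` K i.+1),
      closure (\bigcup_i (K i : set G)) = setT
    & forall (V : set G) (A : nat -> set G),
        open V -> V 1%g ->
        (forall i, A i `<=` K i) ->
        (0 < limn_einf (fun i => (unif_counting (K i) (A i))%:E))%E ->
        unif_counting (K i) [set (x * y)%g | x in V & y in A i]
          @[i --> \oo] --> (1 : R)].

End strong_levy.
Arguments strong_levy R G : clear implicits.

(* [modulus_fun] is only meaningful on [0, +oo[ : nothing is required of its
   values at negative reals. *)
Record modulus (R : realType) := Modulus {
  modulus_fun :> R -> \bar R;
  modulus0 : modulus_fun 0 = 0%E;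
  modulus_gt0 : forall x, 0 < x -> (0 < modulus_fun x)%E;
  modulus_nd : forall x y, 0 < x -> x <= y -> (modulus_fun x <= modulus_fun y)%E;
  modulus_cvg0 : modulus_fun x @[x --> 0^'+] --> 0%E
}.

Definition uniformly_continuous_wrt (R : realType) (u : modulus R)
    (X Y : metricType R) (f : X -> Y) : Prop :=
  forall x y, ((mdist (f x) (f y))%:E <= u (mdist x y))%E.

Record signature (R : realType) := Signature {
  rel_symbol :> finType;
  arity : rel_symbol -> nat;
  arity_gt0 : forall P, (0 < arity P)%N;
  rel_modulus : forall P, 'I_(arity P) -> modulus R
}.

Record prestructure (R : realType) (L : signature R) := Prestructure {
  carrier :> metricType R;
  interp : forall P : L, ('I_(arity P) -> carrier) -> R;
  interp_itv : forall P t, 0 <= @interp P t <= 1;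
  interp_continuous : forall (P : L) (t : 'I_(arity P) -> carrier) i,
    uniformly_continuous_wrt (rel_modulus i)
      (fun x : carrier => @interp P (dfwith t i x) : R^o)
}.
Arguments interp {R L} p P t.

Section signature_classes.
Context (R : realType) (L : signature R).

(* The set I_{P,i}. The radius +oo is left out: every condition below that
   involves I_{P,i} is only used together with its boundedness. *)
Definition small_radii (P : L) (i : 'I_(arity P)) : set R :=
  [set r | 0 <= r /\ (rel_modulus i r < 1)%E].

Definition linear_modulus (P : L) (i : 'I_(arity P)) : Prop :=
  exists2 k : R, 0 < k & {in small_radii i, forall r, rel_modulus i r = (k * r)%:E}.

Definition semiproper : Prop :=
  (forall (P : L) (i : 'I_(arity P)),
     has_ubound (small_radii i) /\
     {in small_radii i &, forall r1 r2,
        (rel_modulus i r1 + rel_modulus i r2 <= rel_modulus i (r1 + r2)%R)%E}) /\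
  (forall P : L, (2 <= arity P)%N -> forall i : 'I_(arity P), linear_modulus i).

(* Semicontinuity of the restriction of [f] to [A]. *)
Definition upper_semicontinuous_on (A : set R) (f : R -> \bar R) : Prop :=
  forall r (a : R), A r -> (f r < a%:E)%E ->
    \forall s \near within A (nbhs r), (f s < a%:E)%E.

Definition proper : Prop :=
  semiproper /\
  forall (P : L) (i : 'I_(arity P)),
    upper_semicontinuous_on (small_radii i) (rel_modulus i).

Definition lipschitz_signature : Prop :=
  proper /\
  forall P : L, arity P = 1%N -> forall i : 'I_(arity P), linear_modulus i.

Definition distance_value_set (D : set R) : Prop :=
  [/\ D !=set0,
      (forall x, D x -> 0 < x)
    & forall x y, D x -> D y ->
        [set z%:E | z in D]
          (Order.min (x + y)%:E (ereal_sup [set z%:E | z in D]))].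

Definition good_value_pair (D V : set R) : Prop :=
  [/\ distance_value_set D,
      V `<=` [set v | 0 <= v <= 1],
      (has_ubound D -> forall (P : L) (i : 'I_(arity P)),
         (1 <= rel_modulus i (sup D))%E),
      V 0
    & forall v d (P : L) (i : 'I_(arity P)), V v -> D d ->
        (rel_modulus i d < v%:E)%E -> V (v - fine (rel_modulus i d))].

Definition normal_value_pair (D V : set R) : Prop :=
  [/\ D = [set ratr q | q in [set q : rat | 0 < q]],
      countable V
    & forall (n : nat) (v : 'I_n -> R), (0 < n)%N -> (forall i, V (v i)) ->
        V (n%:R^-1 * \sum_i v i)].

Definition is_structure (M : prestructure L) : Prop :=
  forall F : set_system M, ProperFilter F -> cauchy F -> exists x : M, F --> x.

Definition valued (D V : set R) (M : prestructure L) : Prop :=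
  (forall x y : M, x <> y -> D (mdist x y)) /\
  (forall P (t : 'I_(arity P) -> M), V (interp M P t)).

Definition is_embedding (M N : prestructure L) (f : M -> N) : Prop :=
  (forall x y, mdist (f x) (f y) = mdist x y) /\
  (forall P (t : 'I_(arity P) -> M), interp N P (f \o t) = interp M P t).

Definition is_isomorphism (M N : prestructure L) (f : M -> N) : Prop :=
  is_embedding f /\ bijective f.

End signature_classes.

Definition Iso (R : realType) (L : signature R) (M : prestructure L) : Type :=
  set_type ([set f | is_isomorphism f] : set {ptws M -> M}).

Definition Iso_fun (R : realType) (L : signature R) (M : prestructure L)
  (s : Iso M) : M -> M := set_val s.
Coercion Iso_fun : Iso >-> Funclass.

Section Iso_theory.
Context (R : realType) (L : signature R).
Implicit Types M N : prestructure L.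

Lemma is_embedding_id M : is_embedding (id : M -> M).
Proof. by []. Qed.

Lemma is_embedding_comp M N N' (g : N -> N') (f : M -> N) :
  is_embedding g -> is_embedding f -> is_embedding (g \o f).
Proof.
move=> [g1 g2] [f1 f2]; split=> [x y|P t]; first by rewrite /= g1 f1.
by rewrite -f2 -g2.
Qed.

Lemma is_isomorphism_inv M N (f : M -> N) (g : N -> M) :
  is_isomorphism f -> cancel f g -> cancel g f -> is_isomorphism g.
Proof.
move=> [[f1 f2] _] fg gf; split; last by exists f.
split=> [x y|P t]; first by rewrite -f1 !gf.
by rewrite -f2; congr (interp _ _ _); apply/funext => i /=; rewrite gf.
Qed.

Variable M : prestructure L.

HB.instance Definition _ := Topological.copy (Iso M)
  (set_type ([set f | is_isomorphism f] : set {ptws M -> M})).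

Lemma IsoP (s : Iso M) : is_isomorphism s.
Proof. exact: set_mem (proj2_sig s). Qed.

Lemma Iso_ext (s t : Iso M) : s =1 t -> s = t.
Proof. by move=> st; apply: val_inj; apply/funext => x; exact: st. Qed.

Definition mkIso (f : M -> M) (Hf : is_isomorphism f) : Iso M :=
  exist _ (f : {ptws M -> M}) (mem_set Hf).

Lemma mkIsoE (f : M -> M) (Hf : is_isomorphism f) x : mkIso Hf x = f x.
Proof. by []. Qed.

Let one_proof : is_isomorphism (id : M -> M).
Proof. by split; [exact: is_embedding_id|exists id]. Qed.

Let mul_proof (s t : Iso M) : is_isomorphism (s \o t).
Proof.
have [s1 s2] := IsoP s; have [t1 t2] := IsoP t.
by split; [exact: is_embedding_comp|exact: bij_comp].
Qed.

Let inv_exists (s : Iso M) : exists g : Iso M, cancel s g /\ cancel g s.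
Proof.
have [_ [g sg gs]] := IsoP s.
by exists (mkIso (is_isomorphism_inv (IsoP s) sg gs)).
Qed.

Definition Iso_one : Iso M := mkIso one_proof.
Definition Iso_mul (s t : Iso M) : Iso M := mkIso (mul_proof s t).
Definition Iso_inv (s : Iso M) : Iso M := projT1 (cid (inv_exists s)).

Let Iso_mulA : associative Iso_mul.
Proof. by move=> s t u; exact: Iso_ext. Qed.
Let Iso_mul1 : left_id Iso_one Iso_mul.
Proof. by move=> s; exact: Iso_ext. Qed.
Let Iso_1mul : right_id Iso_one Iso_mul.
Proof. by move=> s; exact: Iso_ext. Qed.
Let Iso_mulV : left_inverse Iso_one Iso_inv Iso_mul.
Proof.
move=> s; apply: Iso_ext => x; rewrite /Iso_inv; case: cid => g [sg gs].
exact: sg.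
Qed.
Let Iso_Vmul : right_inverse Iso_one Iso_inv Iso_mul.
Proof.
move=> s; apply: Iso_ext => x; rewrite /Iso_inv; case: cid => g [sg gs].
exact: gs.
Qed.

HB.instance Definition _ :=
  isGroup.Build (Iso M) Iso_mulA Iso_mul1 Iso_1mul Iso_mulV Iso_Vmul.

Lemma Iso1E x : (1%g : Iso M) x = x. Proof. by []. Qed.
Lemma IsoME (s t : Iso M) x : ((s * t)%g : Iso M) x = s (t x). Proof. by []. Qed.
Lemma IsoKV (s : Iso M) x : s ((s^-1%g : Iso M) x) = x.
Proof. by rewrite -IsoME mulgV. Qed.
Lemma IsoVK (s : Iso M) x : (s^-1%g : Iso M) (s x) = x.
Proof. by rewrite -IsoME mulVg. Qed.
Lemma Iso_dist (s : Iso M) x y : mdist (s x) (s y) = mdist x y.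
Proof. by have [[]] := IsoP s. Qed.

Lemma Iso_eval_continuous x : continuous (fun s : Iso M => s x).
Proof.
move=> s; have cv : continuous (Iso_fun (M := M) : Iso M -> {ptws M -> M}).
  exact: initial_continuous.
exact: (cvg_comp _ _ (cv s) (@proj_continuous M (fun=> M) x (Iso_fun (s : Iso M)))).
Qed.

Lemma Iso_continuous (X : topologicalType) (f : X -> Iso M) :
  (forall x, continuous (fun s => f s x)) -> continuous f.
Proof.
move=> cf; apply: (@continuous_comp_initial (Iso M) X {ptws M -> M}
  (Iso_fun (M := M)) f).
move=> s; apply/cvg_sup => x U [B [[C oC <-] /= Cx CU]].
have Cs := cf x s C (open_nbhs_nbhs (conj oC Cx)).
apply: (@filterS _ (nbhs s) _ (fun t => C (f t x))) => [t Ct|]; last exact: Cs.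
exact: CU.
Qed.

Lemma Iso_mul_continuous :
  continuous (fun xy : Iso M * Iso M => (xy.1 * xy.2)%g).
Proof.
apply: Iso_continuous => x st; apply/cvg_ballP => e e0.
pose s : Iso M := st.1; pose t : Iso M := st.2.
have e2 : 0 < e / 2 by rewrite divr_gt0.
exists ([set s' : Iso M | ball (s (t x)) (e / 2) (s' (t x))],
        [set t' : Iso M | ball (t x) (e / 2) (t' x)]) => /=.
  split; first exact: (Iso_eval_continuous (nbhsx_ballx (s (t x)) _ e2)).
  exact: (Iso_eval_continuous (nbhsx_ballx (t x) _ e2)).
move=> st' /= [ss' tt']; rewrite (splitr e).
pose s' : Iso M := st'.1; pose t' : Iso M := st'.2.
apply: (@ball_triangle _ _ (s' (t x)) (s (t x)) (s' (t' x)) _ _ ss').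
by move: tt'; rewrite !ballEmdist /= Iso_dist.
Qed.

Lemma Iso_inv_continuous : continuous (fun s : Iso M => (s^-1)%g).
Proof.
apply: Iso_continuous => x s0; pose s : Iso M := s0.
have Fs : Filter (nbhs s) := nbhs_filter s.
apply/(@cvg_ballP R M _ (nbhs s)) => e e0; pose y := (s^-1%g : Iso M) x.
have ys : nbhs s [set t : Iso M | ball (s y) e (t y)].
  exact: (Iso_eval_continuous (nbhsx_ballx (s y) _ e0)).
apply: (@filterS _ _ (nbhs_filter s) _ _ _ ys) => t; rewrite /= !ballEmdist /= IsoKV => xty.
by rewrite -(Iso_dist t) IsoKV metric_sym.
Qed.

Lemma Iso_hausdorff : hausdorff_space (Iso M).
Proof.
move=> s t st; apply: Iso_ext => x; apply: (@metric_hausdorff _ M).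
move=> A B /Iso_eval_continuous sA /Iso_eval_continuous tB.
by have [u [Au Bu]] := st _ _ sA tB; exists ((u : Iso M) x).
Qed.

HB.instance Definition _ := Topological_isTopologicalGroup.Build (Iso M)
  Iso_mul_continuous Iso_inv_continuous Iso_hausdorff.

End Iso_theory.

Record action (R : realType) (L : signature R) (G : groupType)
    (M : prestructure L) := Action {
  act :> G -> M -> M;
  act1 : forall x, act 1%g x = x;
  actM : forall g h x, act (g * h)%g x = act g (act h x);
  act_embedding : forall g, is_embedding (act g)
}.

Section fraisse.
Context (R : realType) (L : signature R).

Definition is_action_embedding (G1 G2 : groupType) (M1 M2 : prestructure L)
    (a1 : action G1 M1) (a2 : action G2 M2) (phi : G1 -> G2) (pi : M1 -> M2) :=
  [/\ {morph phi : g h / (g * h)%g}, injective phi, is_embedding pi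
    & forall g x, a2 (phi g) (pi x) = pi (a1 g x)].

Definition in_K (D V : set R) (A : prestructure L) : Prop :=
  [/\ finite_set [set: A], is_structure A & valued D V A].

(* [U] is countable, its finitely generated substructures are up to isomorphism
   the members of K_(D,V), and it is ultrahomogeneous: two embeddings of a
   member of the class differ by an automorphism. As the language is
   relational, a finite set generates itself. *)
Definition is_fraisse_limit_K (D V : set R) (U : prestructure L) : Prop :=
  [/\ countable [set: U],
      (forall X : set U, finite_set X ->
         exists2 A, in_K D V A &
           exists2 f : A -> U, is_embedding f & range f = X),
      (forall A, in_K D V A -> exists f : A -> U, is_embedding f)
    & forall A, in_K D V A -> forall f g : A -> U,
        is_embedding f -> is_embedding g ->
        exists2 s : U -> U, is_isomorphism s & s \o f = g].

Definition generated_subgroup (G : groupType) (S : set G) : set G :=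
  smallest (fun T : set G => group_closed [in T]) S.

(* Fraisse limit of the class C_(D,V) of actions of finite groups on members of
   K_(D,V). An action is seen as a two-sorted structure; finite sets S of group
   elements and X of points generate the action of the group <S> generated by S
   on the <S>-invariant set <S>X. *)
Definition is_fraisse_limit_C (D V : set R) (H : groupType)
    (M : prestructure L) (a : action H M) : Prop :=
  [/\ countable [set: H] /\ countable [set: M],
      (forall (S : set H) (X : set M), finite_set S -> finite_set X ->
         exists (G : finGroupType) (A : prestructure L) (b : action G A)
           (phi : G -> H) (pi : A -> M),
           [/\ in_K D V A, is_action_embedding b a phi pi,
               range phi = generated_subgroup S
             & range pi = [set a h x | h in generated_subgroup S & x in X]]),
      (forall (G : finGroupType) (A : prestructure L) (b : action G A),
         in_K D V A ->
         exists (phi : G -> H) (pi : A -> M), is_action_embedding b a phi pi)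
    & forall (G : finGroupType) (A : prestructure L) (b : action G A),
        in_K D V A ->
        forall (phi1 phi2 : G -> H) (pi1 pi2 : A -> M),
        is_action_embedding b a phi1 pi1 -> is_action_embedding b a phi2 pi2 ->
        exists (Phi : H -> H) (Pi : M -> M),
          [/\ is_action_embedding a a Phi Pi, bijective Phi, bijective Pi,
              Phi \o phi1 = phi2 & Pi \o pi1 = pi2]].

End fraisse.

Section acting_subgroup.
Context (R : realType) (L : signature R) (H : groupType).
Context (M U : prestructure L) (a : action H M) (iota : M -> U).

(* For an isomorphism [iota], the image of [H] in [Iso U] under
   h |-> iota \o a h \o iota^-1. *)
Definition acting_set : set (Iso U) :=
  [set s | exists h : H, forall x, s (iota x) = iota (a h x)].

Let acting_set_closed : group_closed [in acting_set].
Proof.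
split; first by apply/mem_set; exists 1%g => x; rewrite act1.
move=> s t /set_mem[g sg] /set_mem[h th]; apply/mem_set.
exists (g * h^-1)%g => x; rewrite IsoME actM -sg; congr ((s : Iso U) _).
have -> : iota x = (t : Iso U) (iota (a h^-1%g x)) by rewrite th -actM mulgV act1.
by rewrite IsoVK.
Qed.

Definition acting_subgroup : subgroup (Iso U) := Subgroup acting_set_closed.

End acting_subgroup.

(* Main.v *)
Require Import Defs.
From HB Require Import structures.
From mathcomp Require Import all_boot all_order all_algebra finmap.
From mathcomp Require Import all_classical all_reals all_analysis.
From mathcomp Require Import ring lra.
From mathcomp Require fingroup.
Import fingroup.FinGroup.Exports.

(** The finite subgroups are built by amplification. Any finitely generated part of
    the limit action is an action of a finite group [G] on a finite structure [A].
    The power [G ^ n] acts coordinatewise on [A ^ n]; with the averaged distance and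
    the averaged relations, [A] embeds diagonally, and the values stay admissible
    because the pair of value sets is normal. An element of [G ^ n] with few
    nontrivial coordinates moves the diagonal points by little, and [G ^ n] has
    concentration of measure for the normalized Hamming distance. So, for large [n],
    almost every element of [G ^ n] lies in the blow-up of a given large subset by
    the elements that almost fix [A] ([hamming_concentration],
    [power_action_displacement]). By universality and homogeneity the action of
    [G ^ n] is realized in the limit action over the given copy of [G] acting on [A]
    ([concentrated_step]). Iterating this while enumerating the group and the space
    yields an increasing chain of finite subgroups that exhausts the whole group and
    has the concentration property ([concentrated_sequence]).

    The delicate point is that the averaged relations respect the moduli. A modulus
    is linear at small radii, but it may jump past one while the linear function is
    still below one, and averages do not respect such jumps. For relations of arity at least
    two, jumps that could be seen by the values in [V] contradict amalgamation
    ([no_jump]): one point halfway between two others would be forced to have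
    relation values close to two values that are far apart. So on every member of
    the class the relations are Lipschitz in each coordinate, and averaging is
    harmless. For unary relations jumps may occur, and [A ^ n] is replaced by its
    subset of tuples along which all unary relations are constant; it is invariant
    under [G ^ n] and contains the diagonal.

    The topology enters only through sequences: a sequence of elements that moves
    each point less and less converges to the identity, so any neighbourhood of the
    identity eventually contains the elements that almost fix the first points of
    the enumeration ([nbhs1_small]). The counting measures on the subgroups of the
    chain are images of uniform measures on powers, since homomorphisms carry the
    uniform distribution to the uniform distribution on the image
    ([unif_counting_morph]). *)

Set Implicit Arguments.
Unset Strict Implicit.
Unset Printing Implicit Defensive.

Import Order.TTheory GRing.Theory Num.Theory.
Import numFieldNormedType.Exports.

Local Open Scope classical_set_scope.
Local Open Scope ring_scope.

(** * Means, variance and concentration in the Hamming distance *)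

Definition mean (R : realType) (X : finType) (f : X -> R) : R :=
  #|X|%:R^-1 * \sum_x f x.

Section mean.
Context (R : realType) (X : finType) (x0 : X).
Implicit Types f g : X -> R.

Let cardX_neq0 : #|X|%:R != 0 :> R.
Proof. by rewrite pnatr_eq0 -lt0n; apply/card_gt0P; exists x0. Qed.

Lemma mean_cst (c : R) : mean (fun _ : X => c) = c.
Proof. by rewrite /mean sumr_const -[c *+ _]mulr_natl mulKf. Qed.

Lemma meanD f g : mean (fun x => f x + g x) = mean f + mean g.
Proof. by rewrite /mean big_split mulrDr. Qed.

Lemma meanB f g : mean (fun x => f x - g x) = mean f - mean g.
Proof. by rewrite /mean sumrB mulrBr. Qed.

Lemma meanZ c f : mean (fun x => c * f x) = c * mean f.
Proof. by rewrite /mean -mulr_sumr mulrCA. Qed.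

Lemma le_mean f g : (forall x, f x <= g x) -> mean f <= mean g.
Proof. by move=> fg; rewrite ler_wpM2l ?invr_ge0 // ler_sum. Qed.

Lemma mean_ge0 f : (forall x, 0 <= f x) -> 0 <= mean f.
Proof. by move=> f0; rewrite -(mean_cst 0) le_mean. Qed.

Lemma mean_eq0 f : (forall x, 0 <= f x) -> mean f = 0 -> forall x, f x = 0.
Proof.
move=> f0 /eqP; rewrite mulf_eq0 invr_eq0 (negbTE cardX_neq0) /=.
by rewrite psumr_eq0 => [/allP fE x|//]; apply/eqP/fE; rewrite mem_index_enum.
Qed.

Lemma norm_mean f : `|mean f| <= mean (fun x => `|f x|).
Proof.
by rewrite normrM ger0_norm ?invr_ge0 // ler_wpM2l ?invr_ge0 // ler_norm_sum.
Qed.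

Lemma le_mean_ex f : exists x, f x <= mean f.
Proof.
have [x _ fx] := arg_minP (P := predT) f (i0 := x0) isT.
by exists x; rewrite -[leLHS]mean_cst le_mean // => y; exact: fx.
Qed.

Lemma markov_mean f (Z : {set X}) k : (forall x, 0 <= f x) ->
  (forall x, x \in Z -> k <= f x) -> #|Z|%:R * k <= #|X|%:R * mean f.
Proof.
move=> f0 fk; rewrite /mean mulVKf // (bigID (mem Z)) /=.
rewrite -[leLHS]addr0 lerD //; last by apply: sumr_ge0.
by rewrite mulr_natl -sumr_const; exact: ler_sum.
Qed.

Definition variance f := mean (fun x => f x ^+ 2) - mean f ^+ 2.

(** Bias and variance: in particular the mean square deviation from any constant
    bounds the variance from above. *)
Lemma mean_sqrB f c :
  mean (fun x => (f x - c) ^+ 2) = variance f + (mean f - c) ^+ 2.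
Proof.
have -> : (fun x => (f x - c) ^+ 2) = fun x => f x ^+ 2 - ((2 * c) * f x - c ^+ 2).
  by apply/funext => x; ring.
by rewrite !meanB meanZ mean_cst /variance; ring.
Qed.

Lemma variance_le f c k : (forall x, `|f x - c| <= k) -> variance f <= k ^+ 2.
Proof.
move=> fk; have k0 : 0 <= k := le_trans (normr_ge0 _) (fk x0).
have <- := mean_cst (k ^+ 2).
apply: le_trans (le_mean (f := fun x => (f x - c) ^+ 2) _).
  by rewrite mean_sqrB lerDl sqr_ge0.
by move=> x; rewrite -real_normK ?num_real // ler_sqr // nnegrE.
Qed.

End mean.

Section hamming.
Context (R : realType) (T : finType) (t0 : T).

Definition hamming n (x y : {ffun 'I_n -> T}) : R := \sum_i (x i != y i)%:R.

Lemma hammingxx n (x : {ffun 'I_n -> T}) : hamming x x = 0.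
Proof. by rewrite /hamming big1 // => i _; rewrite eqxx. Qed.

Lemma hamming_triangle n (y x z : {ffun 'I_n -> T}) :
  hamming x z <= hamming x y + hamming y z.
Proof.
rewrite /hamming -big_split /= ler_sum // => i _; rewrite -natrD ler_nat.
by have [->|_] := eqVneq (x i) (y i); case: (x i =P z i).
Qed.

Definition fcons n (a : T) (s : {ffun 'I_n -> T}) : {ffun 'I_n.+1 -> T} :=
  [ffun i => oapp s a (unlift ord0 i)].

Lemma hamming_fcons n a b (s t : {ffun 'I_n -> T}) :
  hamming (fcons a s) (fcons b t) = (a != b)%:R + hamming s t.
Proof.
rewrite /hamming big_ord_recl !ffunE unlift_none /=; congr (_ + _).
by apply: eq_bigr => i _; rewrite !ffunE liftK.
Qed.

(** Fubini for the decomposition of a word into its head and its tail. *)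
Lemma mean_fcons n (f : {ffun 'I_n.+1 -> T} -> R) :
  mean f = mean (fun a => mean (fun s => f (fcons a s))).
Proof.
rewrite /mean -mulr_sumr mulrA -invfM -natrM !card_ffun !card_ord -expnS.
congr (_ * _); rewrite pair_big /= (reindex (fun p => fcons p.1 p.2)) //=.
exists (fun x : {ffun 'I_n.+1 -> T} => (x ord0, [ffun j => x (lift ord0 j)])).
  move=> [a s] _ /=; rewrite ffunE unlift_none /=; congr (_, _).
  by apply/ffunP => j; rewrite !ffunE liftK.
move=> x _; apply/ffunP => i; rewrite ffunE /=.
by case: unliftP => [j|] -> //=; rewrite ffunE.
Qed.

(** By induction on the length: the variance is the mean over the heads of the
    variances in the tail, at most [n], plus the variance of the fibrewise mean,
    which oscillates by at most one since changing the head costs one unit. *)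
Lemma variance_hamming n (f : {ffun 'I_n -> T} -> R) :
  (forall x y, f x - f y <= hamming x y) -> variance f <= n%:R.
Proof.
elim: n f => [|n IHn] f flip.
  have -> : 0%:R = 0 ^+ 2 :> R by rewrite expr0n.
  apply: (variance_le [ffun=> t0] (c := f [ffun=> t0])) => x.
  have := flip x [ffun=> t0]; have := flip [ffun=> t0] x.
  by rewrite /hamming !big_ord0 ler_norml; lra.
pose g a := mean (fun s => f (fcons a s)).
have fibre a : mean (fun s => f (fcons a s) ^+ 2) - g a ^+ 2 <= n%:R.
  apply: IHn => x y; apply: le_trans (flip _ _) _.
  by rewrite hamming_fcons eqxx add0r.
have g_osc a b : g a - g b <= 1.
  rewrite /g -meanB -[leRHS](mean_cst ([ffun=> t0] : {ffun 'I_n -> T})).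
  apply: le_mean => s.
  apply: le_trans (flip _ _) _; rewrite hamming_fcons hammingxx addr0.
  by rewrite lern1 leq_b1.
have base : variance g <= 1.
  have -> : 1 = 1 ^+ 2 :> R by rewrite expr1n.
  apply: (variance_le t0 (c := g t0)) => a; rewrite ler_norml.
  by have := g_osc a t0; have := g_osc t0 a; lra.
have := le_mean fibre; rewrite meanB (mean_cst t0); move: base.
by rewrite /variance !(mean_fcons f) (mean_fcons (fun x => f x ^+ 2)) -natr1; lra.
Qed.

Definition blowup n (B : {set {ffun 'I_n -> T}}) (r : R) :=
  [set x | [exists y in B, hamming x y <= r]]%SET.

Lemma blowupP n (B : {set {ffun 'I_n -> T}}) r x :
  reflect (exists2 y, y \in B & hamming x y <= r) (x \in blowup B r).
Proof. by rewrite inE; exact: exists_inP. Qed.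

(** Concentration of measure on a power, by applying Chebyshev's inequality twice
    to the distance [f] to [B]. As [f] vanishes on the large set [B] and has
    variance at most [n], its mean is at most [e * n / 2]; hence [f] deviates by
    at least [e * n / 2] from its mean wherever it exceeds [e * n]. *)
Lemma hamming_concentration n (B : {set {ffun 'I_n -> T}}) (e c : R) :
  0 < e -> 0 < c -> 4 / (e ^+ 2 * c) <= n%:R ->
  c * #|{ffun 'I_n -> T}|%:R <= #|B|%:R ->
  (1 - c) * #|{ffun 'I_n -> T}|%:R <= #|blowup B (e * n%:R)|%:R.
Proof.
move=> e0 c0 n_large B_large; set N := #|{ffun 'I_n -> T}|.
have N0 : 0 < N%:R :> R.
  by rewrite ltr0n; apply/card_gt0P; exists [ffun=> t0].
have [y0 By0] : exists y, y \in B.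
  by apply/card_gt0P; rewrite -(ltr0n R) (lt_le_trans _ B_large) // mulr_gt0.
have n0 : 0 < n%:R :> R.
  by rewrite (lt_le_trans _ n_large) // divr_gt0 // mulr_gt0 // exprn_gt0.
(* A point of B nearest to x; y0 is the witness required by [arg min]. *)
pose nearest x := [arg min_(y < y0 in B) hamming x y]%O.
pose f x := hamming x (nearest x).
have nearestP x : nearest x \in B /\ forall y, y \in B -> f x <= hamming x y.
  by rewrite /f /nearest; case: arg_minP.
have f0 x : 0 <= f x by apply: sumr_ge0 => i _.
have var_f : variance f <= n%:R.
  apply: variance_hamming => x y; rewrite lerBlDr.
  apply: le_trans (hamming_triangle y _ _).
  exact: (proj2 (nearestP x) _ (proj1 (nearestP y))).
set m := mean f; have m0 : 0 <= m by exact: (mean_ge0 [ffun=> t0]).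
have sqr_dev : mean (fun x => (f x - m) ^+ 2) <= n%:R.
  by rewrite (mean_sqrB [ffun=> t0]) -/m subrr expr0n addr0.
have dev_ge0 x : 0 <= (f x - m) ^+ 2 by exact: sqr_ge0.
have dev_N : N%:R * mean (fun x => (f x - m) ^+ 2) <= N%:R * n%:R.
  by rewrite ler_pM2l.
pose q := (e * n%:R / 2) ^+ 2; have q0 : 0 < q.
  by rewrite exprn_gt0 // divr_gt0 // mulr_gt0.
have n_le_cq : n%:R <= c * q.
  have : 4 <= n%:R * (e ^+ 2 * c) by rewrite -ler_pdivrMr // mulr_gt0 // exprn_gt0.
  rewrite -(ler_pM2l n0); have -> : q = e ^+ 2 * n%:R ^+ 2 / 4 by rewrite /q; field.
  lra.
have m_small : m <= e * n%:R / 2.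
  have fB x : x \in B -> m ^+ 2 <= (f x - m) ^+ 2.
    move=> Bx; have -> : f x = 0; last by rewrite sub0r sqrrN.
    by apply/le_anti; rewrite f0 -(hammingxx x) (proj2 (nearestP x)).
  have cm2 : c * m ^+ 2 <= n%:R.
    rewrite -(ler_pM2l N0); apply: le_trans dev_N.
    apply: le_trans (markov_mean [ffun=> t0] dev_ge0 fB).
    by rewrite mulrA [_ * c]mulrC ler_wpM2r ?sqr_ge0.
  have en0 : 0 <= e * n%:R / 2 by rewrite divr_ge0 ?mulr_ge0 ?(ltW e0).
  rewrite -(ler_sqr (m0 : m \is Num.nneg) en0).
  by rewrite -(ler_pM2l c0) (le_trans cm2).
have far x : x \in ~: blowup B (e * n%:R) -> q <= (f x - m) ^+ 2.
  rewrite !inE => /existsPn/(_ (nearest x)); rewrite (proj1 (nearestP x)) /= -ltNge.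
  rewrite -/(f x) => fx; have en0 : 0 < e * n%:R by rewrite mulr_gt0.
  by rewrite /q ler_sqr ?nnegrE; lra.
have far_card : #|~: blowup B (e * n%:R)|%:R <= c * N%:R.
  rewrite -(ler_pM2r q0); apply: le_trans (markov_mean [ffun=> t0] dev_ge0 far) _.
  by apply: le_trans dev_N _; rewrite mulrAC [leRHS]mulrC ler_pM2l.
by move: far_card; rewrite /N -(cardsC (blowup B (e * n%:R))) natrD; lra.
Qed.

End hamming.

(** * Finite structures *)

Record is_distance (R : realType) (T : Type) (d : T -> T -> R) : Prop :=
  IsDistance {
    distxx : forall x, d x x = 0;
    dist_eq0 : forall x y, d x y = 0 -> x = y;
    distC : forall x y, d x y = d y x;
    dist_triangle : forall y x z, d x z <= d x y + d y z }.

(** Carries the distance [d] in the type, so that [d] determines the metric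
    structure found by inference. *)
Definition metrized (R : realType) (T : choiceType) (d : T -> T -> R)
  (hd : is_distance d) : Type := T.

Section metrized_metric.
Context (R : realType) (T : choiceType) (d : T -> T -> R) (hd : is_distance d).

HB.instance Definition _ := Choice.on (metrized hd).
HB.instance Definition _ := isMetric.Build R (metrized hd)
  (distxx hd) (dist_eq0 hd) (distC hd) (dist_triangle hd).

End metrized_metric.

(** A Cauchy filter on a compact space converges to any of its cluster points. *)
Lemma finite_metric_complete (R : realType) (A : metricType R) :
  finite_set [set: A] ->
  forall F : set_system A, ProperFilter F -> cauchy F -> exists x : A, F --> x.
Proof.
move=> fA F FF Fc; have [x [_ Fx]] := finite_compact fA FF filterT.
exists x; apply/cvg_ballP => e e0.
have [y Fy] : exists y, F (ball y (e / 3)).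
  have /cauchyP := Fc.
  by apply; rewrite divr_gt0.
have [z [yz xz]] := Fx _ _ Fy (nbhsx_ballx x _ (divr_gt0 e0 (ltr0n _ 3))).
apply: filterS Fy => w; move: yz xz; rewrite !ballEmdist /= => yz xz yw.
have := metric_triangle x z w; have := metric_triangle z y w.
rewrite [mdist z y]metric_sym; lra.
Qed.

Section build_prestructure.
Context (R : realType) (L : signature R) (T : choiceType) (d : T -> T -> R).
Context (hd : is_distance d) (r : forall P : L, ('I_(arity P) -> T) -> R).
Hypothesis r_itv : forall P t, 0 <= @r P t <= 1.
Hypothesis r_cont : forall (P : L) (t : 'I_(arity P) -> T) i x y,
  (`|r (dfwith t i x) - r (dfwith t i y)|%:E <= rel_modulus i (d x y))%E.

Let r_uc (P : L) (t : 'I_(arity P) -> metrized hd) i :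
  uniformly_continuous_wrt (rel_modulus i)
    (fun x : metrized hd => @r P (dfwith t i x) : R^o).
Proof. by move=> x y; rewrite [mdist _ _ in leLHS]distrC; exact: r_cont. Qed.

Definition mk_prestructure : prestructure L :=
  @Prestructure R L (metrized hd) r r_itv r_uc.

Lemma mk_prestructure_in_K (D V : set R) :
    finite_set [set: T] -> (forall x y, x <> y -> D (d x y)) ->
    (forall P t, V (@r P t)) ->
  in_K D V mk_prestructure.
Proof. by move=> fT dD rV; split=> // F; exact: finite_metric_complete. Qed.

End build_prestructure.

(** * The Fraisse limit excludes jumps of the moduli *)

Lemma modulus_ge0 (R : realType) (u : modulus R) x : 0 <= x -> (0 <= u x)%E.
Proof.
rewrite le_eqVlt => /orP[/eqP <-|x0]; first by rewrite modulus0.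
exact: ltW (modulus_gt0 u x0).
Qed.

Lemma modulus_le (R : realType) (u : modulus R) x y :
  0 <= x -> x <= y -> (u x <= u y)%E.
Proof.
rewrite le_eqVlt => /orP[/eqP <- y0|x0 xy]; last exact: modulus_nd.
by rewrite modulus0 modulus_ge0.
Qed.

Section apex.
Context (R : realType) (L : signature R) (r w : R).
Hypotheses (r_gt0 : 0 < r) (r_le2w : r <= 2 * w).

Definition pair_dist (x y : bool) : R := if x == y then 0 else r.

Lemma pair_dist_is_distance : is_distance pair_dist.
Proof.
split=> [x|x y|x y|y x z]; rewrite /pair_dist ?eqxx //.
- by case: eqP => // _ rE; move: r_gt0; rewrite rE ltxx.
- by rewrite eq_sym.
- by have := ltW r_gt0; case: x; case: y; case: z => /=; lra.
Qed.

Definition apex_dist (x y : option bool) : R :=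
  match x, y with
  | Some b, Some c => pair_dist b c
  | None, None => 0
  | _, _ => w
  end.

Lemma apex_dist_is_distance : is_distance apex_dist.
Proof.
have w_gt0 : 0 < w by move: r_gt0 r_le2w; lra.
split.
- by case=> [b|] //=; exact: distxx pair_dist_is_distance b.
- case=> [b|] [c|] //= => [/(dist_eq0 pair_dist_is_distance) ->|w0|w0] //;
  by move: w_gt0; rewrite w0 ltxx.
- by case=> [b|] [c|] //=; exact: distC pair_dist_is_distance b c.
- case=> [b|] [c|] [e|] //=; rewrite /pair_dist;
  by move: r_gt0 r_le2w w_gt0; do ?case: eqP; try lra; congruence.
Qed.

Context (P : L) (i : 'I_(arity P)) (v : R).
Hypotheses (v_ge0 : 0 <= v) (v_le1 : v <= 1).

(** The relation [P] takes the value [v] at the single tuple having the base point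
    [true] at coordinate [i] and the apex elsewhere; all other values are [0].
    Comparing coordinates as natural numbers avoids a transport along [Q = P]. *)
Definition apex_rel (Q : L) (t : 'I_(arity Q) -> option bool) : R :=
  if (Q == P) && [forall j : 'I_(arity Q),
       t j == if (j : nat) == i then Some true else None] then v else 0.

Lemma apex_rel_itv Q t : 0 <= @apex_rel Q t <= 1.
Proof.
by rewrite /apex_rel; case: ifP => _; rewrite ?lexx ?v_ge0 ?v_le1 ?ler01.
Qed.

(** A base point occurs in a tuple of nonzero value at the coordinate [i] of [P]
    only, so only this coordinate constrains the distance [r]. *)
Lemma apex_rel_neq0 Q (t : 'I_(arity Q) -> option bool) j b :
  apex_rel t != 0 -> t j = Some b -> Q = P /\ (j : nat) = i.
Proof.
rewrite /apex_rel; case: ifP => [/andP[/eqP QP /forallP tP] _ tj|]; last first.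
  by rewrite eqxx.
by split=> //; move: (tP j); rewrite tj; case: ifP => // /eqP.
Qed.

(* With v = 0 the apex can be a midpoint of the pair; with v > 0 all the distances
   must be so large that they allow a jump from 0 to v. *)
Hypothesis far : v = 0 \/ (1 <= rel_modulus i r)%E /\
  forall (Q : L) (j : 'I_(arity Q)), (1 <= rel_modulus j w)%E.

Lemma apex_rel_cont (Q : L) (t : 'I_(arity Q) -> option bool) j x y :
  (`|apex_rel (dfwith t j x) - apex_rel (dfwith t j y)|%:E
     <= rel_modulus j (apex_dist x y))%E.
Proof.
have dge0 : 0 <= apex_dist x y.
  have dd := apex_dist_is_distance.
  by have := dist_triangle dd y x x; rewrite (distxx dd) (distC dd y x); lra.
have [xyE|xy] := eqVneq x y.
  by move: dge0; rewrite xyE => dge0; rewrite subrr normr0 modulus_ge0.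
case: far => [v0|[far_r far_w]].
  by rewrite /apex_rel v0 !if_same subrr normr0 modulus_ge0.
have diff1 : (`|apex_rel (dfwith t j x) - apex_rel (dfwith t j y)|%:E <= 1)%E.
  rewrite lee_fin ler_norml.
  have := apex_rel_itv (dfwith t j x); have := apex_rel_itv (dfwith t j y); lra.
case: x y xy dge0 diff1 => [b|] [c|] // bc dge0 diff1;
  rewrite /apex_dist; last 2 first.
- exact: le_trans diff1 (far_w _ _).
- exact: le_trans diff1 (far_w _ _).
have d0 : apex_rel (dfwith t j (Some b)) = 0 /\ apex_rel (dfwith t j (Some c)) = 0
    \/ (1 <= rel_modulus j r)%E.
  have [] := pselect (Q = P /\ (j : nat) = i) => [[]|nQP].
    move=> e; move: j t dge0 diff1; rewrite e => j t dge0 diff1 /ord_inj ->.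
    by right.
  left; split; apply/eqP/negPn/negP => nz; apply: nQP;
  apply: (apex_rel_neq0 nz); exact: dfwithin.
rewrite /pair_dist; have [bcE|_] := eqVneq b c; first by rewrite bcE eqxx in bc.
case: d0 => [[-> ->]|far_j]; last exact: le_trans diff1 far_j.
by rewrite subrr normr0 modulus_ge0 // ltW.
Qed.

Definition pair_prestructure : prestructure L.
refine (@mk_prestructure R L bool _ pair_dist_is_distance (fun _ _ => 0) _ _).
  by move=> *; rewrite lexx ler01.
move=> Q t j x y; rewrite subrr normr0 modulus_ge0 // /pair_dist.
by case: ifP => // _; exact: ltW.
Defined.

Definition apex_prestructure : prestructure L :=
  mk_prestructure apex_dist_is_distance apex_rel_itv apex_rel_cont.

Lemma pair_apex_embedding : (2 <= arity P)%N ->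
  is_embedding (Some : pair_prestructure -> apex_prestructure).
Proof.
move=> P2; split=> // Q t; rewrite /interp /=.
(* Coordinates 0 and 1 both hold base points, but only i may. *)
apply/eqP/negPn/negP => nz.
have QP : Q = P by have [] := apex_rel_neq0 (j := Ordinal (arity_gt0 Q)) nz erefl.
have e0 : 0%N = i := proj2 (apex_rel_neq0 (j := Ordinal (arity_gt0 Q)) nz erefl).
rewrite -QP in P2.
have := proj2 (apex_rel_neq0 (j := Ordinal P2) nz erefl).
by rewrite -e0.
Qed.

End apex.

Section no_jump.
Context (R : realType) (L : signature R) (D V : set R) (U : prestructure L).
Hypotheses (hU : is_fraisse_limit_K D V U) (V0 : V 0).
Hypotheses (DE : D = [set ratr q | q in [set q : rat | 0 < q]]).
Hypothesis V01 : V `<=` [set v | 0 <= v <= 1].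
Hypothesis bounded : forall (P : L) (i : 'I_(arity P)), has_ubound (small_radii i).

Lemma D_gt0 x : D x -> 0 < x.
Proof. by rewrite DE => -[q /= q0 <-]; rewrite ltr0q. Qed.

Lemma D_nat n : (0 < n)%N -> D n%:R.
Proof. by move=> n0; rewrite DE; exists n%:R; rewrite /= ?ltr0n ?ratr_nat. Qed.

Lemma D_half x : D x -> D (x / 2).
Proof.
rewrite DE => -[q /= q0 <-]; exists (q / 2); first by rewrite /= divr_gt0.
by rewrite fmorph_div /= ratr_nat.
Qed.

(** Since the sets of small radii are bounded, some admissible distance is out of
    all of them at once. *)
Lemma exists_far r : exists2 w, D w & r <= 2 * w /\
  forall (Q : L) (j : 'I_(arity Q)), (1 <= rel_modulus j w)%E.
Proof.
have : \forall n \near \oo, forall (Q : L) (j : 'I_(arity Q)),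
    (1 <= rel_modulus j n%:R)%E.
  apply: filter_forall => Q; apply: filter_forall => j.
  have [b bP] := bounded j; near=> n; rewrite leNgt; apply/negP => un1.
  have : n%:R <= b by apply: bP; split.
  by apply/negP; rewrite -ltNge; near: n; exact: nbhs_infty_gtr.
move=> [N _ NP]; pose n := maxn N (Num.bound `|r|).
exists n.+1%:R; first exact: D_nat.
split; last by move=> Q j; apply: NP; rewrite /= /n ltnW // ltnS leq_maxl.
have : r <= n%:R.
  rewrite (le_trans (ler_norm _)) // ltW // (lt_le_trans (archi_boundP _)) //.
  by rewrite ler_nat leq_maxr.
by rewrite -natr1; have : 0 <= n%:R :> R by []; lra.
Unshelve. all: by end_near. Qed.

Context (P : L) (i : 'I_(arity P)) (k : R).
Hypotheses (P2 : (2 <= arity P)%N).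
Hypothesis k_lin : {in small_radii i, forall r, rel_modulus i r = (k * r)%:E}.

(** The obstruction to jumps. Let [P] take the values [v] and [0] at two tuples that
    differ at coordinate [i] only, by points at distance [r]; the jump of the modulus
    at [r] permits this for arbitrary [v]. In the Fraisse limit these two points
    also have a midpoint [c], and passing through [c] costs at most [k * (r / 2)]
    twice. The second coordinate is essential: the other entries of the tuple lie
    outside the amalgamated structure that contains the midpoint. *)
Lemma no_jump_step (r v : R) : D r -> V v -> (1 <= rel_modulus i r)%E ->
  (rel_modulus i (r / 2)%R < 1)%E -> v <= k * r.
Proof.
move=> Dr Vv ur1 ur2; have r0 := D_gt0 Dr.
have /andP[v0 v1] := V01 Vv.
have [w Dw [rw wfar]] := exists_far r.
have r_half : r <= 2 * (r / 2) by lra.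
pose A := pair_prestructure L r0.
pose B := apex_prestructure r0 rw v0 v1 (or_intror (conj ur1 wfar)).
pose C := apex_prestructure r0 r_half (i := i) (lexx 0) ler01 (or_introl erefl).
have KA : in_K D V A.
  apply: mk_prestructure_in_K => //; first exact: finite_finset.
  by move=> x y /eqP xy; rewrite /pair_dist ifN.
have Kapex (w' v' : R) (rw' : r <= 2 * w') (v0' : 0 <= v') v1' far' :
    V v' -> D w' ->
    in_K D V (apex_prestructure r0 rw' (P := P) (i := i) v0' v1' far').
  move=> Vv' Dw'; apply: mk_prestructure_in_K; first exact: finite_finset.
    case=> [b|] [c|] //= bc; rewrite /pair_dist ifN //.
    by apply/eqP => bcE; apply: bc; rewrite bcE.
  by move=> Q t; rewrite /apex_rel; case: ifP.
have [_ _ univ homog] := hU.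
have [f fE] := univ B (Kapex _ _ _ _ _ _ Vv Dw).
have [g gE] := univ C (Kapex _ _ _ _ _ _ V0 (D_half Dr)).
have [s [sE _] sg] := homog A KA (g \o Some) (f \o Some)
  (is_embedding_comp gE (pair_apex_embedding _ _ _ _ _ P2))
  (is_embedding_comp fE (pair_apex_embedding _ _ _ _ _ P2)).
pose c := s (g None).
pose t : 'I_(arity P) -> U := fun=> f None.
pose val x := interp U P (dfwith t i x).
have tf x : dfwith t i (f x) = f \o dfwith (fun=> None) i x.
  apply/funext => j /=; have [->|ij] := eqVneq i j; first by rewrite !dfwithin.
  by rewrite !dfwithout.
have va : val (f (Some true)) = v.
  rewrite /val tf (proj2 fE) /interp /= /apex_rel eqxx /=.
  case: ifP => // /negP[]; apply/forallP => j.
  have [<-|ij] := eqVneq i j; first by rewrite dfwithin eqxx.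
  by rewrite dfwithout // ifN // eq_sym.
have vb : val (f (Some false)) = 0.
  rewrite /val tf (proj2 fE) /interp /= /apex_rel eqxx /=.
  case: ifP => // /forallP/(_ i); by rewrite dfwithin eqxx.
have smallr : (r / 2)%R \in small_radii i by apply/mem_set; split=> //; lra.
have close b : `|val c - val (f (Some b))| <= k * (r / 2).
  have <- : s (g (Some b)) = f (Some b) := congr1 (fun h => h b) sg.
  rewrite -lee_fin -(k_lin smallr).
  have <- : mdist (s (g (Some b))) c = r / 2 by rewrite (proj1 sE) (proj1 gE).
  exact: interp_continuous.
have := close true; have := close false; rewrite va vb subr0.
rewrite !ler_norml; lra.
Qed.

(** Halve [r] until its half becomes a small radius. *)
Lemma no_jump (r v : R) : D r -> V v -> (1 <= rel_modulus i r)%E -> v <= k * r.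
Proof.
move=> Dr Vv ur1.
have [n un] : exists n, (rel_modulus i (r / 2 ^+ n)%R < 1)%E.
  have r0 := D_gt0 Dr.
  have [e /= e0 eP] : \forall x \near 0^'+, (rel_modulus i x < 1)%E.
    have o1 : open_nbhs 0%E [set y : \bar R | (y < 1)%E].
      by split; [exact: open_ereal_lt_ereal|exact: lte01].
    exact: (modulus_cvg0 (rel_modulus i) (open_nbhs_nbhs o1)).
  have re : 0 < r / e by rewrite divr_gt0.
  pose n := Num.bound (r / e); exists n.
  have r2n : 0 < r / 2 ^+ n by rewrite divr_gt0 // exprn_gt0.
  apply: eP; rewrite //= sub0r normrN gtr0_norm // ltr_pdivrMr ?exprn_gt0 //.
  rewrite mulrC -ltr_pdivrMr // (lt_trans (archi_boundP (ltW re))) //.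
  by rewrite -natrX ltr_nat ltn_expl.
elim: n r Dr ur1 un => [|n IHn] r Dr ur1 un.
  by move: un; rewrite expr0 divr1 ltNge ur1.
have r0 := D_gt0 Dr.
have [ur2|ur2] := ltP (rel_modulus i (r / 2)) 1%E; first exact: no_jump_step.
have := IHn _ (D_half Dr) ur2; rewrite -mulrA -invfM -exprS => /(_ un).
have v0 : 0 <= v by have /andP[] := V01 Vv.
lra.
Qed.

End no_jump.

(** * Powers of actions *)

(* Finite functions into a finite group already carry a group structure and a finite
   type structure; this declares their join. *)
HB.instance Definition _ (I : finType) (G : finGroupType) :=
  Group.on {ffun I -> G}.

Definition power_group (n : nat) (G : finGroupType) : finGroupType :=
  {ffun 'I_n.+1 -> G}.

Section power.
Context (R : realType) (L : signature R) (D V : set R) (A : prestructure L).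
Context (n : nat).
Hypotheses (DE : D = [set ratr q | q in [set q : rat | 0 < q]]).
Hypothesis V_mean : forall v : 'I_n.+1 -> R, (forall j, V (v j)) -> V (mean v).
Hypothesis KA : in_K D V A.
Hypothesis lipA : forall P : L, (2 <= arity P)%N -> forall i : 'I_(arity P),
  exists k : R, {in small_radii i, forall r, rel_modulus i r = (k * r)%:E} /\
    forall (t : 'I_(arity P) -> A) x y,
      `|interp A P (dfwith t i x) - interp A P (dfwith t i y)| <= k * mdist x y.

(** The values of unary relations are required not to depend on the index because
    the modulus of a unary relation may jump, and then averaging the values over
    the index would break the modulus. *)
Definition unary_constant : pred {ffun 'I_n.+1 -> A} := fun x =>
  [forall P : L, forall j, forall k, (arity P == 1%N) ==>
     (interp A P (fun=> x j) == interp A P (fun=> x k))].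

Definition power_point : choiceType := {x | unary_constant x}.

Lemma unary_constantP (x : power_point) (P : L) j k : arity P = 1%N ->
  interp A P (fun=> val x j) = interp A P (fun=> val x k).
Proof.
move=> P1; have /forallP/(_ P)/forallP/(_ j)/forallP/(_ k) := valP x.
by move=> /implyP/(_ (introT eqP P1))/eqP.
Qed.

Definition power_dist (x y : power_point) : R :=
  mean (fun j => mdist (val x j) (val y j)).

Lemma power_dist_is_distance : is_distance power_dist.
Proof.
split=> [x|x y xy|x y|y x z]; rewrite /power_dist.
- rewrite -[RHS](mean_cst (ord0 : 'I_n.+1) 0); congr mean.
  by apply/funext => j; rewrite mdistxx.
- apply/val_inj/ffunP => j; apply: mdist_positivity.
  exact: (mean_eq0 ord0 (fun j => mdist_ge0 (val x j) (val y j)) xy).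
- by congr mean; apply/funext => j; rewrite metric_sym.
- by rewrite -meanD le_mean // => j; exact: metric_triangle.
Qed.

Lemma finite_power_point : finite_set [set: power_point].
Proof.
have [fA _ _] := KA; pose B := fset_set [set: A].
have inB (a : A) : a \in B by rewrite in_fset_set // in_setT.
have fX : finite_set [set: {ffun 'I_n.+1 -> A}].
  pose lift_B (h : {ffun 'I_n.+1 -> B}) : {ffun 'I_n.+1 -> A} :=
    [ffun j => val (h j)].
  have fB : finite_set (range lift_B).
    by apply: finite_image; exact: finite_finset.
  apply: sub_finite_set fB.
  move=> x _; exists [ffun j => [` inB (x j)]%fset] => //.
  by apply/ffunP => j; rewrite !ffunE.
apply: (@finite_preimage _ _ setT (val : power_point -> _)) => //.
Qed.

Definition power_rel (P : L) (t : 'I_(arity P) -> power_point) : R :=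
  mean (fun j => interp A P (fun i => val (t i) j)).

Lemma power_rel_itv P (t : 'I_(arity P) -> power_point) : 0 <= power_rel t <= 1.
Proof.
have itv j : 0 <= interp A P (fun i => val (t i) j) <= 1 := interp_itv _.
apply/andP; split; first by apply: (mean_ge0 ord0) => j; have /andP[] := itv j.
rewrite -[leRHS](mean_cst (ord0 : 'I_n.+1)); apply: le_mean => j.
by have /andP[] := itv j.
Qed.

Lemma power_dist_ge0 x y : 0 <= power_dist x y.
Proof. by apply: (mean_ge0 ord0) => j; exact: mdist_ge0. Qed.

(** For arity at least two, average the Lipschitz bounds. For arity one, the value
    can be read off at an index where the distance is at most the average, so
    monotonicity of the modulus is enough. *)
Lemma power_rel_cont (P : L) (t : 'I_(arity P) -> power_point) i x y :
  (`|power_rel (dfwith t i x) - power_rel (dfwith t i y)|%:E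
    <= rel_modulus i (power_dist x y))%E.
Proof.
have sub z j : (fun k => val (dfwith t i z k) j) =
    dfwith (fun k => val (t k) j) i (val z j).
  apply/funext => k; have [<-|ik] := eqVneq i k; first by rewrite !dfwithin.
  by rewrite !dfwithout.
have [P2|] := ltnP 1 (arity P).
  have [k [k_lin k_lip]] := lipA P2 i.
  have [small|] := ltP (rel_modulus i (power_dist x y)) 1%E.
    rewrite k_lin ?lee_fin; last first.
      by apply/mem_set; split=> //; exact: power_dist_ge0.
    rewrite /power_rel -meanB (le_trans (norm_mean _)) // /power_dist -meanZ.
    by apply: le_mean => j; rewrite !sub.
  apply: le_trans; rewrite lee_fin ler_norml.
  have := power_rel_itv (dfwith t i x); have := power_rel_itv (dfwith t i y).
  lra.
rewrite leq_eqVlt ltnS leqNgt arity_gt0 orbF => /eqP P1.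
have i_unique (k : 'I_(arity P)) : k = i.
  have val0 (l : 'I_(arity P)) : val l = 0%N.
    by apply/eqP; rewrite -leqn0 -ltnS -P1 ltn_ord.
  by apply: val_inj; rewrite !val0.
have [j jP] := le_mean_ex ord0 (fun j => mdist (val x j) (val y j)).
have unary z : power_rel (dfwith t i z) = interp A P (fun=> val z j).
  rewrite -[RHS](mean_cst (ord0 : 'I_n.+1)); congr mean; apply/funext => l.
  rewrite (unary_constantP z j l P1); congr (interp A P _); apply/funext => k.
  by rewrite (i_unique k) dfwithin.
apply: le_trans (modulus_le _ (mdist_ge0 _ _) jP).
have dE z : power_rel (dfwith t i z) =
    interp A P (dfwith (fun=> val x j) i (val z j)).
  by rewrite unary; congr interp; apply/funext => k; rewrite (i_unique k) dfwithin.
rewrite !dE distrC.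
exact: interp_continuous.
Qed.

Definition power_prestructure : prestructure L :=
  mk_prestructure power_dist_is_distance power_rel_itv power_rel_cont.

Lemma power_in_K : in_K D V power_prestructure.
Proof.
have [fA _ [dA rA]] := KA.
apply: mk_prestructure_in_K finite_power_point _ _ => [x y xy|P t]; last first.
  by apply: V_mean => j; exact: rA.
have d_gt0 : 0 < power_dist x y.
  rewrite lt_neqAle power_dist_ge0 andbT; apply/eqP => /esym d0.
  exact: xy (dist_eq0 power_dist_is_distance d0).
have rat_dist j : exists q : rat, ratr q = mdist (val x j) (val y j).
  have [->|/eqP/dA] := eqVneq (val x j) (val y j).
    by exists 0; rewrite mdistxx rmorph0.
  by rewrite DE => -[q _ qE]; exists q.
pose q j := projT1 (cid (rat_dist j)).
have qE : ratr (#|'I_n.+1|%:R^-1 * \sum_j q j) = power_dist x y.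
  rewrite rmorphM fmorphV /= ratr_nat rmorph_sum /=; congr (_ * _).
  by apply: eq_bigr => j _; rewrite /q; case: cid.
rewrite DE; exists (#|'I_n.+1|%:R^-1 * \sum_j q j) => //=.
by rewrite -(ltr0q R) qE.
Qed.

Definition diag_fun (a : A) : {ffun 'I_n.+1 -> A} := [ffun=> a].

Lemma diag_subproof a : unary_constant (diag_fun a).
Proof.
apply/forallP => P; apply/forallP => j; apply/forallP => k; apply/implyP => _.
by rewrite /diag_fun !ffunE.
Qed.

Definition power_diag (a : A) : power_prestructure :=
  exist (fun x => is_true (unary_constant x)) _ (diag_subproof a).

Lemma power_diag_embedding : is_embedding power_diag.
Proof.
split=> [x y|P t]; rewrite -[RHS](mean_cst (ord0 : 'I_n.+1));
  congr mean; apply/funext => j.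
  by rewrite /= !ffunE.
by congr (interp A P _); apply/funext => i; exact: ffunE.
Qed.

Context (G : finGroupType) (b : action G A).

Lemma power_act_subproof (g : power_group n G) (x : power_point) :
  unary_constant [ffun j => b (g j) (val x j)].
Proof.
apply/forallP => P; apply/forallP => j; apply/forallP => k; apply/implyP => /eqP P1.
have bE l : interp A P (fun=> [ffun j => b (g j) (val x j)] l) =
    interp A P (fun=> val x l).
  by rewrite -[RHS](proj2 (act_embedding b (g l))) ffunE.
by rewrite !bE (unary_constantP x j k).
Qed.

Definition power_act (g : power_group n G) (x : power_prestructure) :
    power_prestructure :=
  exist (fun x => is_true (unary_constant x)) _ (power_act_subproof g x).

Lemma power_act1 x : power_act 1%g x = x.
Proof.
by apply/val_inj/ffunP => j; rewrite /= !ffunE act1.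
Qed.

Lemma power_actM g h x : power_act (g * h)%g x = power_act g (power_act h x).
Proof.
by apply/val_inj/ffunP => j; rewrite /= !ffunE actM.
Qed.

Lemma power_act_embedding g : is_embedding (power_act g).
Proof.
split=> [x y|P t]; congr mean; apply/funext => j.
  by rewrite /= !ffunE (proj1 (act_embedding b (g j))).
rewrite -[RHS](proj2 (act_embedding b (g j))); congr (interp A P _).
by apply/funext => i; rewrite /= ffunE.
Qed.

Definition power_action : action (power_group n G) power_prestructure :=
  Action power_act1 power_actM power_act_embedding.

Definition group_diag (g : G) : power_group n G := [ffun=> g].

Lemma power_diag_action_embedding :
  is_action_embedding b power_action group_diag power_diag.
Proof.
split=> [g h|g h gh||g x].
- by apply/ffunP => j; rewrite !ffunE.
- by have := congr1 (fun f : power_group n G => f ord0) gh; rewrite !ffunE.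
- exact: power_diag_embedding.
- by apply/val_inj/ffunP => j; rewrite /= !ffunE.
Qed.

(** At most the diameter of [A] times the normalized Hamming distance from [g] to
    the identity, because trivial coordinates contribute nothing. *)
Lemma power_action_displacement (g : power_group n G) x :
  mdist (power_action g (power_diag x)) (power_diag x) =
  mean (fun j => mdist (b (g j) x) x).
Proof. by congr mean; apply/funext => j; rewrite /= !ffunE. Qed.

End power.

(** * Concentrated finite subgroups *)

Lemma finite_metric_bounded (R : realType) (A : metricType R) :
  finite_set [set: A] -> exists2 d : R, 0 < d & forall x y : A, mdist x y <= d.
Proof.
move=> fA; pose B := fset_set [set: A].
have inB (a : A) : a \in B by rewrite in_fset_set // in_setT.
exists (1 + \sum_(x : B) \sum_(y : B) mdist (val x) (val y)).
  apply: ltr_pwDl => //; apply: sumr_ge0 => x _; apply: sumr_ge0 => y _.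
  exact: mdist_ge0.
move=> x y; rewrite -[leLHS]add0r lerD //.
rewrite (bigD1 [` inB x]%fset) //= (bigD1 [` inB y]%fset) //= -addrA lerDl.
rewrite addr_ge0 // sumr_ge0 // => *; rewrite ?sumr_ge0 // => *; exact: mdist_ge0.
Qed.

Lemma morph_group1 (G H : groupType) (f : G -> H) :
  {morph f : x y / (x * y)%g} -> f 1%g = 1%g.
Proof. by move=> fM; apply: (mulgI (f 1%g)); rewrite -fM !mulg1. Qed.

Lemma morph_groupV (G H : groupType) (f : G -> H) :
  {morph f : x y / (x * y)%g} -> {morph f : x / (x^-1)%g}.
Proof.
by move=> fM x; apply: (mulgI (f x)); rewrite -fM !mulgV morph_group1.
Qed.

Lemma is_action_embedding_comp (R : realType) (L : signature R)
    (G1 G2 G3 : groupType) (M1 M2 M3 : prestructure L)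
    (a1 : action G1 M1) (a2 : action G2 M2) (a3 : action G3 M3)
    (phi : G1 -> G2) (pi : M1 -> M2) (psi : G2 -> G3) (rho : M2 -> M3) :
  is_action_embedding a2 a3 psi rho -> is_action_embedding a1 a2 phi pi ->
  is_action_embedding a1 a3 (psi \o phi) (rho \o pi).
Proof.
move=> [psiM psiI rhoE eq2] [phiM phiI piE eq1]; split.
- by move=> g h /=; rewrite phiM psiM.
- exact: inj_comp.
- exact: is_embedding_comp.
- by move=> g x /=; rewrite eq2 eq1.
Qed.

(** Blow-up by [N] turns large subsets of [G] into almost full ones. *)
Definition concentrated (R : realType) (G : finGroupType) (e : R) (N : set G) :=
  forall B : {set G}, e * #|G|%:R <= #|B|%:R ->
  exists2 B' : {set G}, (1 - e) * #|G|%:R <= #|B'|%:R &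
    forall k, k \in B' -> exists2 b, b \in B & N (k * b^-1)%g.

Section step.
Context (R : realType) (L : signature R) (D V : set R).
Hypotheses (hL : lipschitz_signature L) (hgood : good_value_pair L D V).
Hypothesis hnormal : normal_value_pair D V.
Context (U : prestructure L).
Hypothesis hU : is_fraisse_limit_K D V U.

(** On a member of the class the linear bound holds at all distances, including
    those beyond the small radii: the only obstacle would be a jump. *)
Lemma in_K_lipschitz (A : prestructure L) : in_K D V A ->
  forall P : L, (2 <= arity P)%N -> forall i : 'I_(arity P),
  exists k : R, {in small_radii i, forall r, rel_modulus i r = (k * r)%:E} /\
    forall (t : 'I_(arity P) -> A) x y,
      `|interp A P (dfwith t i x) - interp A P (dfwith t i y)| <= k * mdist x y.
Proof.
move=> [_ _ [dA rA]] P P2 i.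
have [[[bnd lin] _] _] := hL; have [k k0 k_lin] := lin P P2 i.
have [_ V01 _ V0 _] := hgood; have [DE _ _] := hnormal.
exists k; split=> // t x y; rewrite -lee_fin.
have [small|large] := ltP (rel_modulus i (mdist x y)) 1%E.
  rewrite -(k_lin (mdist x y)); last by apply/mem_set; split=> //; exact: mdist_ge0.
  by rewrite distrC; exact: interp_continuous.
have xy : x <> y by move=> xy; move: large; rewrite xy mdistxx modulus0 leNgt lte01.
have bound z := no_jump hU V0 DE V01 (fun P i => proj1 (bnd P i)) P2 k_lin
  (dA _ _ xy) (rA P (dfwith t i z)) large.
rewrite lee_fin ler_norml.
have := bound x; have := bound y.
have /andP[] := interp_itv (p := A) (dfwith t i x).
have /andP[] := interp_itv (p := A) (dfwith t i y).
lra.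
Qed.

Context (H : groupType) (M : prestructure L) (a : action H M).
Hypothesis hHM : is_fraisse_limit_C D V a.

(** The sets [S] and [X] generate an action of a finite group [G0] on a finite
    structure [A]. For large [n] the power action of [G0 ^ n] on a subset of
    [A ^ n] is concentrated; universality places it inside [a], and homogeneity
    moves it there so that it extends the given copy of [G0] acting on [A]. *)
Lemma concentrated_step (S : set H) (X : set M) (e : R) :
    finite_set S -> finite_set X -> 0 < e ->
  exists (G : finGroupType) (phi : G -> H),
  [/\ {morph phi : g h / (g * h)%g}, S `<=` range phi &
    concentrated e [set g | forall x, X x -> mdist (a (phi g) x) x <= e]].
Proof.
move=> fS fX e0; have [_ fg univ homog] := hHM.
have [_ _ _ V0 _] := hgood; have [DE _ V_avg] := hnormal.
have [G0 [A [b [phi0 [pi0 [KA emb0 phi0S pi0X]]]]]] := fg S X fS fX.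
have [fA _ _] := KA; have [diam diam0 diamP] := finite_metric_bounded fA.
(* Elements at Hamming distance at most eps * n.+1 differ by an element moving each
   diagonal point by at most eps * diam = e. *)
pose eps := e / diam; have eps0 : 0 < eps by rewrite divr_gt0.
pose n := Num.bound (4 / (eps ^+ 2 * e)).
have n_large : 4 / (eps ^+ 2 * e) <= n.+1%:R.
  have q0 : 0 <= 4 / (eps ^+ 2 * e).
    by rewrite divr_ge0 // mulr_ge0 ?exprn_ge0 ?ltW.
  by rewrite (le_trans (ltW (archi_boundP q0))) // ler_nat.
have V_mean (v : 'I_n.+1 -> R) : (forall j, V (v j)) -> V (mean v).
  by move=> Vv; rewrite /mean card_ord; exact: V_avg.
have KAn := power_in_K DE V_mean KA (in_K_lipschitz KA).
have emb_diag := power_diag_action_embedding n (in_K_lipschitz KA) b.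
have [psi [rho emb1]] :=
  univ (power_group n G0) _ (power_action n (in_K_lipschitz KA) b) KAn.
have [Phi [Pi [emb2 _ _ PhiE PiE]]] := homog G0 A b KA _ _ _ _
  (is_action_embedding_comp emb1 emb_diag) emb0.
have [phiM _ [piE _] piA] := is_action_embedding_comp emb2 emb1.
exists (power_group n G0), (Phi \o psi); split=> //.
  move=> s Ss; have : generated_subgroup S s by exact: sub_gen_smallest.
  by rewrite -phi0S -PhiE => -[g _ <-]; exists (group_diag n g).
move=> B B_large; exists (blowup B (eps * n.+1%:R)).
  exact: (hamming_concentration (1%g : G0) eps0 e0 n_large B_large).
move=> k /blowupP[y By ky]; exists y => // x Xx.
have [z _ <-] : range pi0 x.
  rewrite pi0X; exists 1%g; last by exists x; rewrite ?act1.
  rewrite -phi0S; exists 1%g => //; apply: morph_group1.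
  by have [] := emb0.
rewrite -PiE /= (piA (k * y^-1)%g (power_diag _ _ z)) piE.
rewrite power_action_displacement.
apply: (@le_trans _ _ (diam * mean (fun j => (k j != y j)%:R))).
  rewrite -meanZ; apply: le_mean => j.
  rewrite !ffunE.
  have [->|_] := eqVneq (k j) (y j); last by rewrite mulr1 diamP.
  by rewrite mulgV act1 mdistxx mulr0.
rewrite /mean card_ord mulrCA ler_pdivrMl ?ltr0n //.
rewrite -ler_pdivlMl // (le_trans ky) // /eps.
by rewrite [e * _]mulrC [n.+1%:R * e]mulrC mulrA.
Qed.

End step.

(** * Counting measures, topology and lower limits *)

Section counting.
Context (R : realType) (G : finGroupType) (H : topologicalGroupType).
Context (f : G -> H).
Hypothesis fM : {morph f : x y / (x * y)%g}.

(** All fibres of a homomorphism over its image are translates of the kernel. *)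
Lemma card_morph_preim (F : {fset H}) : [set` F] `<=` range f ->
  (#|[set x | f x == 1%g]%SET| * #|` F| = #|[set x | f x \in F]%SET|)%N.
Proof.
move=> Ff; rewrite -!sum1_card.
rewrite [RHS]big_mkcond /=.
transitivity (\sum_x \sum_(b <- F) (f x == b : nat)).
  rewrite exchange_big /= -sum1_size big_distrr /=.
  rewrite [LHS]big_seq [RHS]big_seq; apply: eq_bigr => b /Ff[y _ <-].
  rewrite muln1 [RHS](reindex_inj (mulIg y)) /= big_mkcond /=.
  apply: eq_bigr => x _.
  have -> : (f (x * y)%g == f y) = (f x == 1%g).
    apply/eqP/eqP => [fxy|fx]; last by rewrite fM fx mul1g.
    by apply: (mulIg (f y)); rewrite -fM fxy mul1g.
  by rewrite inE; case: (_ == _).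
apply: eq_bigr => x _; rewrite inE -[RHS]/(nat_of_bool (f x \in F)).
rewrite -(count_uniq_mem _ (fset_uniq F)) -sum1_count [RHS]big_mkcond.
by apply: eq_bigr => b _; rewrite /= eq_sym; case: (_ == _).
Qed.

(** The common size of the fibres cancels in the quotient. *)
Lemma unif_counting_morph (K A : set H) : K = range f ->
  unif_counting R K A = #|[set x | `[< A (f x) >]]%SET|%:R / #|G|%:R.
Proof.
move=> KE; have fK : finite_set K.
  by rewrite KE; apply: finite_image; exact: finite_finset.
have fAK : finite_set (A `&` K) by apply: finite_setIr.
pose k := #|[set x | f x == 1%g]%SET|.
have k_neq0 : k%:R != 0 :> R.
  rewrite pnatr_eq0 -lt0n; apply/card_gt0P; exists 1%g.
  by rewrite inE morph_group1.
have inK x : K (f x) by rewrite KE; exists x.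
have cardA : (k * #|` fset_set (A `&` K)| = #|[set x | `[< A (f x) >]]%SET|)%N.
  rewrite card_morph_preim; last by rewrite fset_setK // KE => ? [].
  apply: eq_card => x; rewrite !inE in_fset_set //.
  by apply/idP/asboolP => [/set_mem[]|Ax] //; apply/mem_set.
have cardK : (k * #|` fset_set K| = #|G|)%N.
  rewrite card_morph_preim; last by rewrite fset_setK // KE.
  by apply: eq_card => x; rewrite !inE in_fset_set //; apply/mem_set.
by rewrite /unif_counting -cardA -cardK !natrM -mulf_div divff // mul1r.
Qed.

End counting.

Lemma Iso_cvg (R : realType) (L : signature R) (M : prestructure L)
    (s : nat -> Iso M) (t : Iso M) :
  (forall x, s n x @[n --> \oo] --> t x) -> s @ \oo --> t.
Proof.
move=> st A [B [[C oC <-] /= Ct CA]].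
have st' : (fun n => Iso_fun (s n) : {ptws M -> M}) @ \oo -->
    (Iso_fun t : {ptws M -> M}).
  apply/cvg_sup => x W [B' [[E oE <-] /= Ex EW]].
  have En : \forall n \near \oo, E (s n x) :=
    st x E (open_nbhs_nbhs (conj oE Ex)).
  by near=> n; apply: EW => /=; near: n.
have Cn : \forall n \near \oo, C (Iso_fun (s n)) :=
  st' C (open_nbhs_nbhs (conj oC Ct)).
by near=> n; apply: CA => /=; near: n.
Unshelve. all: by end_near. Qed.

Lemma subgroup_cvg (G : topologicalGroupType) (K : subgroup G)
    (s : nat -> subgroup_type K) (t : subgroup_type K) :
  subgroup_val (s n) @[n --> \oo] --> subgroup_val t -> s @ \oo --> t.
Proof.
move=> st A [B [[C oC <-] /= Ct CA]].
have Cn : \forall n \near \oo, C (subgroup_val (s n)) :=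
  st C (open_nbhs_nbhs (conj oC Ct)).
by near=> n; apply: CA => /=; near: n.
Unshelve. all: by end_near. Qed.

Lemma limn_einf_gt0 (R : realType) (u : nat -> R) :
  (0 < limn_einf (fun i => (u i)%:E))%E ->
  exists2 c : R, 0 < c & \forall i \near \oo, c <= u i.
Proof.
rewrite limn_einf_lim => l0.
have [c c0 cl] : exists2 c : R, 0 < c &
    (c%:E < limn (einfs (fun i => (u i)%:E)))%E.
  case: (limn _) l0 => [r||] //= r0.
    by exists (r / 2); rewrite ?lte_fin; move: r0; rewrite lte_fin; lra.
  by exists 1; rewrite ?ltry.
exists c => //.
have := lte_lim (@nondecreasing_einfs _ _) (@is_cvg_einfs _ _) cl.
apply: filterS => i ci; rewrite -lee_fin; apply: le_trans ci _.
by apply: ereal_inf_lbound; exists i => //=.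
Qed.

(** * The chain of finite subgroups *)

Section chain.
Context (R : realType) (L : signature R) (D V : set R).
Hypotheses (hL : lipschitz_signature L) (hgood : good_value_pair L D V).
Hypothesis hnormal : normal_value_pair D V.
Context (U : prestructure L).
Hypothesis hU : is_fraisse_limit_K D V U.
Context (H : groupType) (M : prestructure L) (a : action H M).
Hypothesis hHM : is_fraisse_limit_C D V a.
Context (iota : M -> U).
Hypothesis hiota : is_isomorphism iota.

Notation GH := (subgroup_type (acting_subgroup a iota)).

Lemma acting_lift (h : H) : exists s : GH,
  forall x, (subgroup_val s : Iso U) (iota x) = iota (a h x).
Proof.
have [iotaE [j iotaK jK]] := hiota.
have f_iso : is_isomorphism (iota \o a h \o j).
  split.
    apply: is_embedding_comp; last first.
      by have [] := is_isomorphism_inv hiota iotaK jK.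
    exact: is_embedding_comp iotaE (act_embedding a h).
  exists (iota \o a h^-1%g \o j) => x /=; rewrite iotaK -actM.
    by rewrite mulVg act1.
  by rewrite mulgV act1.
have fP x : mkIso f_iso (iota x) = iota (a h x) by rewrite mkIsoE /= iotaK.
by exists (exist _ (mkIso f_iso) (mem_set (ex_intro _ h fP))).
Qed.

Definition lift_act (h : H) : GH := projT1 (cid (acting_lift h)).

Lemma lift_actE h x :
  (subgroup_val (lift_act h) : Iso U) (iota x) = iota (a h x).
Proof. by rewrite /lift_act; case: cid. Qed.

Lemma acting_ext (s t : GH) :
  (forall x, (subgroup_val s : Iso U) (iota x) =
             (subgroup_val t : Iso U) (iota x)) ->
  s = t.
Proof.
have [_ [j _ jK]] := hiota.
by move=> st; apply: subgroup_val_inj; apply: Iso_ext => u; rewrite -(jK u).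
Qed.

Lemma lift_actM : {morph lift_act : g h / (g * h)%g}.
Proof.
move=> g h; apply: acting_ext => x.
by rewrite subgroup_valM IsoME !lift_actE actM.
Qed.

Lemma lift_act_surj (s : GH) : exists h, lift_act h = s.
Proof.
have [h hP] := set_mem (valP s); exists h; apply: acting_ext => x.
by rewrite lift_actE -hP.
Qed.

Definition near1 (f : M -> nat) (i : nat) : set GH :=
  [set s | forall x, (f x <= i)%N ->
     mdist ((subgroup_val s : Iso U) (iota x)) (iota x) <= i.+1%:R^-1].

(** Otherwise one could pick, for all [N], an element of [near1 f (i N)] outside [W]
    with [i N >= N]; such a sequence converges pointwise to the identity. *)
Lemma nbhs1_small (f : M -> nat) (W : set GH) : open W -> W 1%g ->
  \forall i \near \oo, near1 f i `<=` W.
Proof.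
move=> oW W1; apply: contrapT => bad.
have bad_seq N : exists i, (N <= i)%N /\ exists s : GH, near1 f i s /\ ~ W s.
  apply: contrapT => none; apply: bad; exists N => // i /= Ni s sP.
  apply: contrapT => nW; apply: none; exists i; split=> //.
  by exists s.
have [i iP] := choice bad_seq.
have [s sP] := choice (fun N => proj2 (iP N)).
have s1 : s @ \oo --> (1%g : GH).
  apply: subgroup_cvg; apply: Iso_cvg => u.
  have [_ [j _ jK]] := hiota; rewrite subgroup_val1 Iso1E -(jK u).
  apply/cvg_ballP => e e0; near=> N; rewrite ballEmdist /= metric_sym.
  have fN : (f (j u) <= i N)%N.
    by rewrite (leq_trans _ (proj1 (iP N))) //; near: N; exact: nbhs_infty_ge.
  apply: le_lt_trans (proj1 (sP N) _ fN) _.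
  apply: (@le_lt_trans _ _ N.+1%:R^-1).
    by rewrite lef_pV2 ?posrE ?ltr0n // ler_nat ltnS (proj1 (iP N)).
  near: N; exact: near_infty_natSinv_lt (PosNum e0).
have [N _ NP] := s1 _ (open_nbhs_nbhs (conj oW W1)).
exact: (proj2 (sP N)) (NP N (leqnn N)).
Unshelve. all: by end_near. Qed.

Definition concentrated_stage (e : R) (X : set M) (S T : set H) : Prop :=
  exists (G : finGroupType) (phi : G -> H),
  [/\ {morph phi : g h / (g * h)%g}, S `<=` T, T = range phi &
    concentrated e [set g | forall x, X x -> mdist (a (phi g) x) x <= e]].

(** Iterate [concentrated_step]; the injections into the natural numbers enumerate
    the points on which concentration is tested and the elements of [H] that the
    finite groups must absorb. *)
Lemma concentrated_sequence (f : M -> nat) (g : H -> nat) :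
  injective f -> injective g ->
  exists S : nat -> set H, forall i,
    [/\ [set h | (g h <= i)%N] `<=` S i, S i `<=` S i.+1 &
      exists T, concentrated_stage i.+1%:R^-1 [set x | (f x <= i)%N] T (S i)].
Proof.
move=> f_inj g_inj.
have finite_below (T : Type) (h : T -> nat) i : injective h ->
    finite_set [set x | (h x <= i)%N].
  move=> h_inj; apply: (@finite_preimage _ _ `I_i.+1 h _ (finite_II _)).
  by move=> x y _ _; exact: h_inj.
pose fin := {S : set H | finite_set S}.
have step (p : nat * fin) : exists T : fin,
    concentrated_stage p.1.+1%:R^-1 [set x | (f x <= p.1)%N]
      (sval p.2 `|` [set h | (g h <= p.1)%N]) (sval T).
  case: p => i [S fS] /=.
  have fS' : finite_set (S `|` [set h | (g h <= i)%N]).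
    by rewrite finite_setU; split=> //; exact: finite_below.
  have e0 : 0 < i.+1%:R^-1 :> R by rewrite invr_gt0.
  have [G [phi [phiM Sphi conc]]] :=
    concentrated_step hL hgood hnormal hU hHM fS' (finite_below _ f i f_inj) e0.
  have fphi : finite_set (range phi).
    by apply: finite_image; exact: finite_finset.
  by exists (exist _ _ fphi) => /=; exists G, phi.
have [next nextP] := choice step.
pose fix stage i : fin := if i is i'.+1 then next (i, stage i')
  else next (0%N, exist _ set0 (finite_set0 H)).
exists (fun i => sval (stage i)) => i; split.
- move=> h hi; case: i hi => [|i] hi /=.
    have [G [phi [_ sub _ _]]] := nextP (0%N, exist _ set0 (finite_set0 H)).
    by apply: sub; right.
  by have [G [phi [_ sub _ _]]] := nextP (i.+1, stage i); apply: sub; right.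
- have [G [phi [_ sub _ _]]] := nextP (i.+1, stage i).
  by move=> h Sh; apply: sub; left.
- by case: i => [|i]; eexists; exact: (nextP (_, _)).
Qed.

End chain.

Theorem theorem8p14 (R : realType) (L : signature R) (D V : set R)
    (hL : lipschitz_signature L)
    (hgood : good_value_pair L D V) (hnormal : normal_value_pair D V)
    (U : prestructure L) (hU : is_fraisse_limit_K D V U)
    (H : groupType) (M : prestructure L) (a : action H M)
    (hHM : is_fraisse_limit_C D V a)
    (iota : M -> U) (hiota : is_isomorphism iota) :
  strong_levy R (subgroup_type (acting_subgroup a iota)).
Proof.
have [[cH cM] _ _ _] := hHM.
have /countable_injP[f f_inj'] := cM.
have f_inj : injective f by move=> x y; apply: f_inj'; exact: in_setT.
have /countable_injP[g g_inj'] := cH.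
have g_inj : injective g by move=> x y; apply: g_inj'; exact: in_setT.
have [S SP] := concentrated_sequence hL hgood hnormal hU hHM f_inj g_inj.
have K_closed i : group_closed [in lift_act a hiota @` S i].
  have [_ _ [T [G [phi [phiM _ -> _]]]]] := SP i.
  split.
    apply/mem_set; exists (phi 1%g); first by exists 1%g.
    by rewrite !morph_group1 //; exact: lift_actM.
  move=> s t /set_mem[_ [x _ <-] <-] /set_mem[_ [y _ <-] <-]; apply/mem_set.
  exists (phi (x * y^-1)%g); first by exists (x * y^-1)%g.
  by rewrite phiM (morph_groupV phiM) lift_actM (morph_groupV (lift_actM a hiota)).
pose K i := Subgroup (K_closed i).
have KP i : exists (G : finGroupType)
    (psi : G -> subgroup_type (acting_subgroup a iota)),
  [/\ {morph psi : g h / (g * h)%g}, subgroup_set (K i) = range psi &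
    concentrated (i.+1%:R^-1 : R)
      [set g | near1 (a := a) (iota := iota) f i (psi g)]].
  have [_ _ [T [G [phi [phiM _ SE conc]]]]] := SP i.
  exists G, (lift_act a hiota \o phi); split.
  - by move=> x y /=; rewrite phiM lift_actM.
  - by rewrite /= SE image_comp.
  - move=> B /conc[B' B'_large B'P]; exists B' => // k /B'P[b Bb bP].
    exists b => // x fx; rewrite /= lift_actE (proj1 (proj1 hiota)).
    exact: bP.
exists K; split.
- move=> i; have [G [psi [_ -> _]]] := KP i.
  by apply: finite_image; exact: finite_finset.
- by move=> i _ [h Sh <-]; exists h => //; have [_ sub _] := SP i; exact: sub.
- apply/seteqP; split=> // s _; apply: subset_closure.
  have [h <-] := lift_act_surj hiota s; exists (g h) => //; exists h => //.
  by have [sub _ _] := SP (g h); apply: sub => /=.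
move=> W A oW W1 AK /limn_einf_gt0[c c0 c_le].
pose WA i := [set (x * y)%g | x in W & y in A i].
apply: (@squeeze_cvgr _ _ _ _ (fun i : nat => 1 - i.+1%:R^-1) (fun=> 1));
  last 2 first.
- rewrite -[X in _ --> X]subr0; apply: cvgB; [exact: cvg_cst|exact: cvg_harmonic].
- exact: cvg_cst.
near=> i.
have [G [psi [psiM KE conc]]] := KP i.
have G0 : 0 < #|G|%:R :> R by rewrite ltr0n; apply/card_gt0P; exists 1%g.
rewrite (unif_counting_morph R psiM (WA i) KE); apply/andP; split; last first.
  by rewrite ler_pdivrMr // mul1r ler_nat max_card.
have [] := conc [set x | `[< A i (psi x) >]]%SET.
  rewrite -ler_pdivlMr // -(unif_counting_morph R psiM (A i) KE).
  apply: (@le_trans _ _ c); last by near: i.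
  apply: ltW; near: i; exact: near_infty_natSinv_lt (PosNum c0).
(* An element k of B' is the product of k * b^-1, which almost fixes the first
   points, and of b, which maps into A i. *)
move=> B' B'_large B'P; rewrite ler_pdivlMr // (le_trans B'_large) // ler_nat.
apply: subset_leq_card; apply/fintype.subsetP => k /B'P[b].
rewrite !inE => Ab bP.
exists (psi (k * b^-1)%g); last first.
  by exists (psi b); rewrite // -psiM -mulgA mulVg mulg1.
have near_W : near1 (a := a) (iota := iota) f i `<=` W.
  by near: i; exact: nbhs1_small.
exact: near_W.
Unshelve. all: by end_near. Qed.
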